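(* Let $n\in\mathbb N$, $\alpha>0$, $1<p<\infty$ and $\frac1p+\frac1{p'}=1$. For nonzero $g\in\mathcal{H}^n_{p,\alpha}$ and nonzero $h\in\mathcal{H}^n_{p',\alpha}$ set \[ \mathcal{R}_{p,\alpha}(g,h)=\frac{|\langle g,h\rangle_\alpha|}{\|g\|_{p,\alpha}\|h\|_{p',\alpha}}. \] Then \[ C_p^{n/2}\le \sup_{g\in\mathcal{H}^n_{p,\alpha}\setminus\{0\}}\ \sup_{h\in\mathcal{H}^n_{p',\alpha}\setminus\{0\}}\mathcal{R}_{p,\alpha}(g,h)\le C_p^n. \]
   Context: For $\alpha>0$ and $n\in\mathbb N$, $\gamma^n_\alpha(dz)=(\alpha/\pi)^n e^{-\alpha|z|^2}\lambda^n(dz)$ on $\mathbb C^n$, with $\lambda^n$ Lebesgue measure. For $1\le p<\infty$, $\mathcal{H}^n_{p,\alpha}$ is the space of holomorphic $f$ on $\mathbb C^n$ with $\|f\|_{p,\alpha}:=\left(\int|f|^p\,d\gamma^n_{\alpha p/2}\right)^{1/p}<\infty$. $\langle f,g\rangle_\alpha=\int f\overline{g}\,d\gamma^n_\alpha$. $C_p=2\,p^{-1/p}\,(p')^{-1/p'}$. *)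

(* Defs.v *)
From HB Require Import structures.
From mathcomp Require Import all_boot all_order all_algebra.
From mathcomp Require Import all_classical all_reals all_analysis.
From mathcomp Require Import complex.
Import Order.TTheory GRing.Theory Num.Theory.
Local Open Scope classical_set_scope.
Local Open Scope ring_scope.

(* Points of C are represented, for measure-theoretic purposes, by pairs
   (x, y) : R * R (the point x + i y); C^n by n-tuples of such pairs.
   [toC] / [rowC] transport them to the complex field R[i] and to the
   complex vector space 'rV[R[i]]_n, where holomorphy is defined. *)

Definition toC (R : realType) (p : (R * R)%type) : R[i] := Complex p.1 p.2.

Definition rowC (R : realType) (n : nat) (t : n.-tuple (R * R)%type)
  : 'rV[R[i]]_n := \row_j toC R (tnth t j).

Definition lebC (R : realType) : set (R * R)%type -> \bar R :=
  (@lebesgue_measure R \x @lebesgue_measure R)%E.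

Fixpoint lebCn (R : realType) (n : nat) : set (n.-tuple (R * R)%type) -> \bar R :=
  match n return set (n.-tuple (R * R)%type) -> \bar R with
  | 0 => \d_ [tuple]
  | m.+1 => pushforward (lebC R \x lebCn R m)%E
              (fun zw : ((R * R) * m.-tuple (R * R))%type =>
                 [tuple of zw.1 :: zw.2])
  end.

Definition sqnorm (R : realType) (n : nat) (t : n.-tuple (R * R)%type) : R :=
  \sum_(j < n) ((tnth t j).1 ^+ 2 + (tnth t j).2 ^+ 2).

Definition gaussCn (R : realType) (n : nat) (alpha : R)
  : set (n.-tuple (R * R)%type) -> \bar R :=
  fun A => (\int[lebCn R n]_(t in A)
              ((alpha / pi) ^+ n * expR (- alpha * sqnorm R n t))%:E)%E.

(* holomorphic functions on C^n: complex (Frechet) differentiable at every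
   point, the derivative being R[i]-linear *)
Definition holomorphic (R : realType) (n : nat) (f : 'rV[R[i]]_n -> R[i]) : Prop :=
  forall z, differentiable (f : 'rV[R[i]]_n -> (R[i])^o) z.

Definition pint (R : realType) (n : nat) (p alpha : R) (f : 'rV[R[i]]_n -> R[i])
  : \bar R :=
  (\int[gaussCn R n (alpha * p / 2)]_t ((ComplexField.Normc.normc (f (rowC R n t))) `^ p)%:E)%E.

Definition Hspace (R : realType) (n : nat) (p alpha : R) : set ('rV[R[i]]_n -> R[i]) :=
  [set f | holomorphic R n f /\ (pint R n p alpha f < +oo)%E].

Definition pnorm (R : realType) (n : nat) (p alpha : R) (f : 'rV[R[i]]_n -> R[i]) : R :=
  (fine (pint R n p alpha f)) `^ (p^-1).

Definition inner (R : realType) (n : nat) (alpha : R) (f g : 'rV[R[i]]_n -> R[i]) : R[i] :=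
  Complex
    (fine (\int[gaussCn R n alpha]_t
       (complex.Re (f (rowC R n t) * conjc (g (rowC R n t))))%:E)%E)
    (fine (\int[gaussCn R n alpha]_t
       (complex.Im (f (rowC R n t) * conjc (g (rowC R n t))))%:E)%E).

Definition ratio (R : realType) (n : nat) (p p' alpha : R) (g h : 'rV[R[i]]_n -> R[i]) : R :=
  ComplexField.Normc.normc (inner R n alpha g h) / (pnorm R n p alpha g * pnorm R n p' alpha h).

Definition Cp (R : realType) (p p' : R) : R :=
  2 * p `^ (- p^-1) * p' `^ (- p'^-1).

Definition ratios (R : realType) (n : nat) (p p' alpha : R) : set R :=
  [set r | exists g h, [/\ g \in Hspace R n p alpha, g <> (fun=> 0),
      h \in Hspace R n p' alpha, h <> (fun=> 0) & r = ratio R n p p' alpha g h]].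

(* Main.v *)
Require Import Defs.
From HB Require Import structures.
From mathcomp Require Import all_boot all_order all_algebra.
From mathcomp Require Import all_classical all_reals all_analysis.
From mathcomp Require Import measurable_realfun complex ring lra.
Import Order.TTheory GRing.Theory Num.Theory.
Import numFieldNormedType.Exports.
Local Open Scope classical_set_scope.
Local Open Scope ring_scope.
Set Implicit Arguments.
Unset Strict Implicit.
Unset Printing Implicit Defensive.

(* The upper bound is Hoelder's inequality on C^n with Lebesgue measure, applied
   to |g| exp(-alpha |z|^2 / 2) and |h| exp(-alpha |z|^2 / 2); the constant Cp^n
   collects the normalisations of the three Gaussian measures.

   For the lower bound take g = exp(alpha s (z_1^2 + ... + z_n^2) / 2) and h the
   same function with t in place of s, where s = 1 - d^2 / p, t = 1 - d^2 / p'
   and d -> 0.  The norms of g and h are explicit Gaussian integrals.  The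
   real part of g * conj h is a Gaussian times cos u, where u is
   alpha (s - t) times the sum of the x_j y_j; since cos u >= 2 - exp |u| and
   |u| <= (alpha / 2) sum_j (d^3 x_j^2 + d y_j^2), the oscillation is negligible
   and the pairing is bounded below by Gaussian integrals again, which gives a
   ratio of at least (2 (1 - d)^n - 1) Cp^(n/2). *)

(** * Measures given by a density *)

Section density.
Local Open Scope ereal_scope.
Context (d : measure_display) (T : measurableType d) (R : realType).
Variables (mu : {measure set T -> \bar R}) (w : T -> R).
Hypotheses (w0 : forall x, (0 <= w x)%R) (mw : measurable_fun setT w).

Definition density (A : set T) : \bar R := \int[mu]_(x in A) (w x)%:E.

Let mwE : measurable_fun setT (EFin \o w).
Proof. exact/measurable_EFinP. Qed.

Lemma density0 : density set0 = 0.
Proof. by rewrite /density integral_set0. Qed.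

Lemma density_ge0 A : 0 <= density A.
Proof. by apply: integral_ge0 => x _; rewrite lee_fin. Qed.

Lemma density_semi_sigma_additive : semi_sigma_additive density.
Proof.
move=> A mA tA mUA; rewrite /density ge0_integral_bigcup//=.
- apply: is_cvg_ereal_nneg_natsum_cond => n _ _.
  exact: density_ge0.
- exact: measurable_funTS.
- by move=> x _; rewrite lee_fin.
Qed.

HB.instance Definition _ := isMeasure.Build _ _ _ density
  density0 density_ge0 density_semi_sigma_additive.

Definition density_measure : {measure set T -> \bar R} := density.

Import HBNNSimple.

(** Monotone convergence along simple approximations reduces both sides to simple functions.
    Linearity then leaves indicators, for which the identity is the definition of [density]. *)
Lemma ge0_integral_density (f : T -> \bar R) :
  measurable_fun setT f -> (forall x, 0 <= f x) ->
  \int[density]_x f x = \int[mu]_x (f x * (w x)%:E).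
Proof.
move=> mf f0; pose h := nnsfun_approx measurableT mf.
have -> : \int[density]_x f x = lim (\int[density]_x (EFin \o h n) x @[n --> \oo]).
  have fE x : f x = lim ((EFin \o h n) x @[n --> \oo]).
    by apply/esym/cvg_lim => //; exact: cvg_nnsfun_approx.
  under eq_integral => x _ do rewrite fE.
  apply: monotone_convergence => //.
  - by move=> n; exact/measurable_EFinP.
  - by move=> n x _; rewrite lee_fin.
  - by move=> x _ a b ab; rewrite lee_fin; exact/lefP/nd_nnsfun_approx.
have -> : \int[mu]_x (f x * (w x)%:E) =
    lim (\int[mu]_x ((EFin \o h n) x * (w x)%:E) @[n --> \oo]).
  have fE x : f x * (w x)%:E = lim ((EFin \o h n) x * (w x)%:E @[n --> \oo]).
    apply/esym/cvg_lim => //; apply: cvgeZr => //.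
    exact: cvg_nnsfun_approx.
  under eq_integral => x _ do rewrite fE.
  apply: monotone_convergence => //.
  - move=> n; apply: emeasurable_funM => //; exact/measurable_EFinP.
  - by move=> n x _; rewrite mule_ge0// lee_fin.
  - move=> x _ a b ab; rewrite lee_wpmul2r ?lee_fin//.
    exact/lefP/nd_nnsfun_approx.
congr (lim (_ @ \oo)); apply/funext => n.
transitivity (\int[density]_x (\sum_(y \in range (h n))
    (y * \1_(h n @^-1` [set y]) x)%:E)).
  by apply: eq_integral => t _; rewrite /= fimfunE -fsumEFin.
rewrite ge0_integral_fsum//; last 2 first.
- by move=> y; apply/measurable_EFinP/measurable_funM.
- by move=> m y _; exact: nnfun_muleindic_ge0.
transitivity (\int[mu]_x (\sum_(y \in range (h n))
    (y * \1_(h n @^-1` [set y]) x)%:E * (w x)%:E)); last first.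
  apply: eq_integral => x _; rewrite -ge0_mule_fsuml; last first.
    by move=> y; exact: nnfun_muleindic_ge0.
  by rewrite /= fimfunE -fsumEFin.
rewrite ge0_integral_fsum//; last 2 first.
- move=> y; apply: emeasurable_funM => //.
  by apply/measurable_EFinP/measurable_funM.
- by move=> m y _; rewrite mule_ge0 ?lee_fin//; exact: nnfun_muleindic_ge0.
apply: eq_fsbigr => r; rewrite inE => -[t _ <-].
under eq_integral do rewrite EFinM.
under [RHS]eq_integral do rewrite EFinM -muleA.
have m1 : measurable_fun setT (EFin \o \1_(h n @^-1` [set h n t]) : T -> \bar R).
  exact/measurable_EFinP.
have m2 := emeasurable_funM m1 mwE.
have i0 x : setT x -> 0 <= (\1_(h n @^-1` [set h n t]) x)%:E * (w x)%:E.
  by rewrite mule_ge0 ?lee_fin.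
rewrite !ge0_integralZl ?lee_fin//.
rewrite integral_indic//= setIT /density integral_mkcond; congr (_ * _).
apply: eq_integral => x _ /=.
by rewrite patchE indicE; case: ifPn => _; rewrite ?mul1e ?mul0e.
Qed.

(** Since [w] is nonnegative, the positive and negative parts of [f * w] are those of [f] times [w].
    The identity therefore holds part by part, without integrability. *)
Lemma integral_density (f : T -> R) : measurable_fun setT f ->
  \int[density]_x (f x)%:E = \int[mu]_x (f x * w x)%:E.
Proof.
move=> mf; have mfE : measurable_fun setT (EFin \o f) by exact/measurable_EFinP.
rewrite [LHS]integralE [RHS]integralE; congr (_ - _).
  rewrite ge0_integral_density//; last exact: measurable_funepos.
  by apply: eq_integral => x _; rewrite !funeposE /= EFinM maxe_pMl ?lee_fin// mul0e.
rewrite ge0_integral_density//; last exact: measurable_funeneg.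
by apply: eq_integral => x _; rewrite !funenegE /= -mulNr EFinM maxe_pMl ?lee_fin// mul0e.
Qed.

End density.

(** * Sigma-finiteness of products and pushforwards *)

Section sigma_finite_product.
Local Open Scope ereal_scope.
Context (d1 d2 : measure_display) (T1 : measurableType d1)
  (T2 : measurableType d2) (R : realType).
Variables (m1 : {sigma_finite_measure set T1 -> \bar R})
  (m2 : {sigma_finite_measure set T2 -> \bar R}).

(** Both exhaustions are taken nondecreasing, so the diagonal rectangles [F k] times [G k] already
    cover the product. *)
Lemma product_measure1_sigma_finite : sigma_finite setT (m1 \x m2).
Proof.
have /sigma_finiteP[F [TF ndF Foo]] := sigma_finiteT m1.
have /sigma_finiteP[G [TG ndG Goo]] := sigma_finiteT m2.
exists (fun k => F k `*` G k).
  rewrite -setXTT TF TG; apply/seteqP; split => [[x y]|[x y] [k _ []/= ? ?]].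
    move=> [/= [i _ Fix] [j _ Gjy]]; exists (maxn i j) => //; split.
      by move: x Fix; exact/subsetPset/ndF/leq_maxl.
    by move: y Gjy; exact/subsetPset/ndG/leq_maxr.
  by split; exists k.
move=> k; have [? ?] := Foo k; have [? ?] := Goo k.
split; first exact: measurableX.
by rewrite product_measure1E// lte_mul_pinfty// ge0_fin_numE.
Qed.

(** The existential form lets a destructuring rewrite replace the bare product by a measure carrying
    its sigma-finiteness, as Tonelli's theorem and further products require. *)
Lemma product_measure1_ex :
  exists nu : {sigma_finite_measure set (T1 * T2)%type -> \bar R},
    (nu : set _ -> _) = m1 \x m2.
Proof.
pose mu : {measure set (T1 * T2)%type -> \bar R} := m1 \x m2.
pose M := @Measure_isSigmaFinite.Build _ _ _ mu product_measure1_sigma_finite.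
pose nu := HB.pack_for (SigmaFiniteMeasure.type (T1 * T2)%type R) (Measure.sort mu) M.
by exists nu.
Qed.

End sigma_finite_product.

Section sigma_finite_pushforward.
Local Open Scope ereal_scope.
Context (d1 d2 : measure_display) (T1 : measurableType d1)
  (T2 : measurableType d2) (R : realType).
Variables (mu : {sigma_finite_measure set T1 -> \bar R}) (f : T1 -> T2) (g : T2 -> T1).
Hypotheses (mf : measurable_fun setT f) (mg : measurable_fun setT g) (fK : cancel f g).

(** Pull an exhaustion back along the left inverse [g]: since [g \o f] is the identity, the
    pushforward gives these sets the original finite measures. *)
Lemma sigma_finite_pushforward : sigma_finite setT (pushforward mu f).
Proof.
have /sigma_finiteP[F [TF _ Foo]] := sigma_finiteT mu.
exists (fun k => g @^-1` F k).
  by rewrite -preimage_bigcup -TF preimage_setT.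
move=> k; have [mF Fk] := Foo k; split.
  by rewrite -[_ @^-1` _]setTI; exact: mg.
rewrite /pushforward -comp_preimage (_ : g \o f = id) ?preimage_id//.
exact/funext.
Qed.

Let pushforward_measure : {measure set T2 -> \bar R} :=
  measure_function_pushforward__canonical__measure_function_Measure mu mf.

Lemma sigma_finite_pushforward_ex :
  exists nu : {sigma_finite_measure set T2 -> \bar R},
    (nu : set T2 -> \bar R) = pushforward mu f.
Proof.
pose M := @Measure_isSigmaFinite.Build _ _ _ pushforward_measure sigma_finite_pushforward.
pose nuS := HB.pack_for (SigmaFiniteMeasure.type T2 R) (Measure.sort pushforward_measure) M.
by exists nuS.
Qed.

End sigma_finite_pushforward.

(** * Lebesgue measure on C^n and Gaussian integrals *)

Section lebesgue_Cn.
Context (R : realType).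
Local Open Scope ereal_scope.
Local Notation CC := (R * R)%type.

(* [R] and [measurableTypeR R] have the same measurable sets but different
   displays, hence a pushforward along the identity. *)
Lemma lebC_pushforward : lebC R =
  pushforward (@lebesgue_measure R \x @lebesgue_measure R) (id : _ -> CC).
Proof. by []. Qed.

Lemma lebC_ex : exists mu : {sigma_finite_measure set CC -> \bar R},
  (mu : set _ -> _) = lebC R.
Proof.
have [mu muE] := product_measure1_ex (@lebesgue_measure R) (@lebesgue_measure R).
have := @sigma_finite_pushforward_ex _ _ _ CC R mu id id.
case=> [||//|nu nuE]; [exact: measurable_id|exact: measurable_id|exists nu].
by rewrite nuE muE.
Qed.

Definition consC (n : nat) (zw : (CC * n.-tuple CC)%type) : n.+1.-tuple CC :=
  [tuple of zw.1 :: zw.2].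

Lemma measurable_consC n : measurable_fun setT (@consC n).
Proof. exact: (measurable_cons measurable_fst measurable_snd). Qed.

Lemma lebCn_ex n :
  exists mu : {sigma_finite_measure set (n.-tuple CC) -> \bar R},
    (mu : set _ -> _) = lebCn R n.
Proof.
elim: n => [|n [mu muE]].
  by exists (\d_ ([tuple] : 0.-tuple CC)).
have [muC muCE] := lebC_ex.
have [nu' nu'E] := product_measure1_ex muC mu.
(* The measurable left inverse of [consC] splits a tuple into its head and its tail. *)
have := @sigma_finite_pushforward_ex _ _ _ _ _ nu' (@consC n)
    (fun t : n.+1.-tuple CC => (thead t, [tuple of behead t])).
case=> [||[z w]|nu nuE].
- exact: measurable_consC.
- apply/measurable_fun_pairP; split.
    exact: measurable_tnth.
  exact: measurable_behead.
- by rewrite /consC /= theadE; congr (_, _); apply/val_inj.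
- by exists nu; rewrite nuE nu'E muCE muE.
Qed.

Lemma ge0_integral_lebC (f : CC -> \bar R) :
  measurable_fun setT f -> (forall x, 0 <= f x) ->
  \int[lebC R]_z f z =
  \int[@lebesgue_measure R]_x \int[@lebesgue_measure R]_y f (x, y).
Proof.
move=> mf f0.
rewrite lebC_pushforward (@ge0_integral_pushforward _ _ _ CC)//.
by rewrite preimage_setT fubini_tonelli1.
Qed.

Lemma ge0_integral_lebCnS n (f : n.+1.-tuple CC -> \bar R) :
  measurable_fun setT f -> (forall x, 0 <= f x) ->
  \int[lebCn R n.+1]_t f t =
  \int[lebC R]_z \int[lebCn R n]_w f [tuple of z :: w].
Proof.
move=> mf f0 /=; have [mu <-] := lebCn_ex n; have [muC <-] := lebC_ex.
rewrite (@ge0_integral_pushforward _ _ _ _ _ (@consC n))//.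
- rewrite preimage_setT fubini_tonelli1//.
  + exact: (measurableT_comp mf (@measurable_consC n)).
  + by move=> x; exact: f0.
- exact: measurable_consC.
Qed.

Lemma gauss_integral1 (a : R) : (0 < a)%R ->
  \int[@lebesgue_measure R]_x (expR (- (a * x ^+ 2)))%:E = (Num.sqrt (pi / a))%:E.
Proof.
(* The standard deviation for which the normal density has exponent [- a * x ^+ 2]. Its total mass 1
   then gives the integral as the inverse of the peak value. *)
move=> a0; pose s := (Num.sqrt (2 * a)^-1)%R.
have s0 : (0 < s)%R by rewrite sqrtr_gt0 invr_gt0 mulr_gt0.
have s2 : (s ^+ 2 *+ 2 = a^-1)%R.
  rewrite sqr_sqrtr ?invr_ge0 ?mulr_ge0// ?(ltW a0)//.
  by rewrite -mulr_natr; field; rewrite gt_eqF.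
have := integral_normal_pdf 0 s.
under eq_integral do rewrite normal_pdfE ?gt_eqF// EFinM.
rewrite ge0_integralZl//=.
- move=> /(congr1 (fun z => (normal_peak s)^-1%:E * z)).
  rewrite muleA -EFinM mulVf ?gt_eqF ?normal_peak_gt0 ?gt_eqF// mul1e mule1 => H.
  transitivity ((normal_peak s)^-1)%:E.
    rewrite -H; apply: eq_integral => x _.
    by rewrite /normal_fun subr0 s2 invrK mulNr mulrC.
  rewrite /normal_peak invrK; congr (Num.sqrt _)%:E.
  by rewrite -mulrnAl s2 mulrC.
- by apply/measurable_EFinP; exact: (measurable_normal_fun 0 s).
- by move=> x _; rewrite lee_fin normal_fun_ge0.
- by rewrite lee_fin normal_peak_ge0.
Qed.

(** Separate weights on real and imaginary parts cover every exponent that occurs: |z|^2 has weights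
    (1, 1) and the real part of the sum of the z_j^2 has weights (1, -1). *)
Definition qform (n : nat) (a c : R) (t : n.-tuple CC) : R :=
  (\sum_(j < n) (a * (tnth t j).1 ^+ 2 + c * (tnth t j).2 ^+ 2))%R.

Lemma measurable_tnth1 n j : measurable_fun setT (fun t : n.-tuple CC => (tnth t j).1).
Proof. exact: (measurableT_comp measurable_fst (measurable_tnth j)). Qed.

Lemma measurable_tnth2 n j : measurable_fun setT (fun t : n.-tuple CC => (tnth t j).2).
Proof. exact: (measurableT_comp measurable_snd (measurable_tnth j)). Qed.

Lemma measurable_qform n a c : measurable_fun setT (@qform n a c).
Proof.
apply: measurable_sum => j; apply: measurable_funD.
  apply: measurable_funM => //; apply: measurable_funX; exact: measurable_tnth1.
apply: measurable_funM => //; apply: measurable_funX; exact: measurable_tnth2.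
Qed.

Lemma qform_cons n a c (z : CC) (t : n.-tuple CC) :
  qform a c [tuple of z :: t] = (a * z.1 ^+ 2 + c * z.2 ^+ 2 + qform a c t)%R.
Proof.
rewrite /qform big_ord_recl /= tnth0; congr (_ + _)%R.
by apply: eq_bigr => j _; rewrite tnthS.
Qed.

Lemma measurable_gauss_Cn n a c :
  measurable_fun setT (fun t : n.-tuple CC => expR (- qform a c t)).
Proof.
by apply: measurableT_comp => //; apply: measurableT_comp => //; exact: measurable_qform.
Qed.

Lemma gauss_integral_C (a c : R) : (0 < a)%R -> (0 < c)%R ->
  \int[lebC R]_z (expR (- (a * z.1 ^+ 2 + c * z.2 ^+ 2)))%:E =
  (pi / Num.sqrt (a * c))%:E.
Proof.
move=> a0 c0.
have mE : measurable_fun setT (fun z : CC => (expR (- (a * z.1 ^+ 2 + c * z.2 ^+ 2)))%:E).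
  apply/measurable_EFinP; apply: measurableT_comp => //; apply: measurableT_comp => //.
  by apply: measurable_funD; apply: measurable_funM => //; exact: measurable_funX.
rewrite ge0_integral_lebC//=.
have mg b : measurable_fun [set: measurableTypeR R] (fun x => (expR (- (b * x ^+ 2)))%:E).
  apply/measurable_EFinP; apply: measurableT_comp => //; apply: measurableT_comp => //.
  by apply: measurable_funM => //; exact: measurable_funX.
under eq_integral => x _.
  under eq_integral do rewrite opprD expRD EFinM.
  rewrite ge0_integralZl//=.
  rewrite gauss_integral1//; over.
rewrite ge0_integralZr//=.
rewrite gauss_integral1// -EFinM; congr EFin.
have p0 := pi_ge0 R.
rewrite -sqrtrM ?divr_ge0// ?(ltW a0)// mulf_div sqrtrM ?mulr_ge0//.
by rewrite sqrtrV ?mulr_ge0 ?(ltW a0) ?(ltW c0)// -expr2 sqrtr_sqr ger0_norm.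
Qed.

Lemma gauss_integral_Cn n (a c : R) : (0 < a)%R -> (0 < c)%R ->
  \int[lebCn R n]_t (expR (- qform a c t))%:E =
  ((pi / Num.sqrt (a * c)) ^+ n)%:E.
Proof.
move=> a0 c0; elim: n => [|n IH].
  (* In dimension 0 the measure is the Dirac mass at the empty tuple, so the integral is 1. *)
  rewrite (eq_integral (cst 1)) => [|t _]; last by rewrite /qform big_ord0 oppr0 expR0.
  by rewrite /= integral_cst//= mul1e expr0 /dirac indicE in_setT.
rewrite ge0_integral_lebCnS//; last by apply/measurable_EFinP; exact: measurable_gauss_Cn.
have mz : measurable_fun setT (fun z : CC => (expR (- (a * z.1 ^+ 2 + c * z.2 ^+ 2)))%:E).
  apply/measurable_EFinP; apply: measurableT_comp => //; apply: measurableT_comp => //.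
  by apply: measurable_funD; apply: measurable_funM => //; exact: measurable_funX.
have := gauss_integral_C a0 c0; have [muC <-] := lebC_ex => HC.
move: IH; have [mu <-] := lebCn_ex n => IH.
under eq_integral => z _.
  under eq_integral do rewrite qform_cons opprD expRD EFinM.
  rewrite ge0_integralZl//=; last by apply/measurable_EFinP; exact: measurable_gauss_Cn.
  rewrite IH; over.
by rewrite ge0_integralZr// ?HC -?EFinM -?exprS// lee_fin exprn_ge0// divr_ge0// ?pi_ge0.
Qed.

End lebesgue_Cn.

(** * The Gaussian measures as weighted Lebesgue measures *)

Section lebCn_measure.
Context (R : realType) (n : nat).
Local Open Scope ereal_scope.

Let lebCn0 : lebCn R n set0 = 0.
Proof. by have [mu <-] := lebCn_ex R n. Qed.

Let lebCn_ge0 A : 0 <= lebCn R n A.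
Proof. by have [mu <-] := lebCn_ex R n. Qed.

Let lebCn_semi_sigma_additive : semi_sigma_additive (lebCn R n).
Proof. by have [mu <-] := lebCn_ex R n; exact: measure_semi_sigma_additive. Qed.

HB.instance Definition _ := isMeasure.Build _ _ _ (lebCn R n)
  lebCn0 lebCn_ge0 lebCn_semi_sigma_additive.

End lebCn_measure.

Section gaussCn_measure.
Context (R : realType) (n : nat).
Local Open Scope ereal_scope.
Local Notation CC := (R * R)%type.

Lemma sqnormE (t : n.-tuple CC) : sqnorm R n t = qform 1 1 t.
Proof. by apply: eq_bigr => j _; rewrite !mul1r. Qed.

Lemma mul_qform (k a c : R) (t : n.-tuple CC) :
  (k * qform a c t = qform (k * a) (k * c) t)%R.
Proof. by rewrite /qform mulr_sumr; apply: eq_bigr => j _; rewrite mulrDr !mulrA. Qed.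

Lemma gauss_density (a : R) (t : n.-tuple CC) :
  (expR (- a * sqnorm R n t) = expR (- qform a a t))%R.
Proof. by rewrite sqnormE mulNr mul_qform mulr1. Qed.

Definition gaussw (a : R) (t : n.-tuple CC) : R :=
  ((a / pi) ^+ n * expR (- a * sqnorm R n t))%R.

Lemma gaussCnE a : gaussCn R n a = density (lebCn R n) (gaussw a).
Proof. by []. Qed.

Lemma measurable_gaussw a : measurable_fun setT (gaussw a).
Proof.
apply: measurable_funM => //; under eq_fun do rewrite gauss_density.
exact: measurable_gauss_Cn.
Qed.

Lemma gaussw_ge0 a t : (0 <= a)%R -> (0 <= gaussw a t)%R.
Proof. by move=> a0; rewrite mulr_ge0 ?expR_ge0// exprn_ge0// divr_ge0// pi_ge0. Qed.

Lemma gaussCn_ex a : (0 <= a)%R ->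
  exists mu : {measure set (n.-tuple CC) -> \bar R}, (mu : set _ -> _) = gaussCn R n a.
Proof.
move=> a0; pose w0 t := gaussw_ge0 t a0.
by exists (density_measure (lebCn R n) w0 (measurable_gaussw a)).
Qed.

Lemma integral_gaussCn a (f : n.-tuple CC -> R) : (0 <= a)%R -> measurable_fun setT f ->
  \int[gaussCn R n a]_t (f t)%:E = \int[lebCn R n]_t (f t * gaussw a t)%:E.
Proof.
move=> a0 mf; rewrite gaussCnE integral_density//.
- by move=> t; exact: gaussw_ge0.
- exact: measurable_gaussw.
Qed.

End gaussCn_measure.

(** * Measurability of continuous functions on tuples *)

Section box_continuity.
Context (R : realType) (n : nat).
Local Notation CC := (R * R)%type.

(** The open ball of the sup norm on the 2n real coordinates. *)
Definition near_box (d : R) (t u : n.-tuple CC) : Prop :=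
  forall j, `|(tnth u j).1 - (tnth t j).1| < d /\ `|(tnth u j).2 - (tnth t j).2| < d.

Definition ratr_tuple (q : n.-tuple (rat * rat)) : n.-tuple CC :=
  [tuple (ratr (tnth q j).1, ratr (tnth q j).2) | j < n].

Lemma measurable_near_box d t : measurable [set u | near_box d t u].
Proof.
have lt_meas (f : n.-tuple CC -> R) (a e : R) : measurable_fun setT f ->
    measurable [set t | `|f t - a| < e].
  move=> mf; have mg : measurable_fun setT (fun t => `|f t - a|).
    by apply: measurableT_comp => //; exact: measurable_funB.
  have -> : [set t | `|f t - a| < e] = setT `&` (fun t => `|f t - a|) @^-1` `]-oo, e[%classic.
    by rewrite setTI; apply/seteqP; split => u /=; rewrite in_itv.
  by apply: mg => //; exact: measurable_itv.
rewrite (_ : mkset _ = \bigcap_(j in [set: 'I_n])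
    ([set u | `|(tnth u j).1 - (tnth t j).1| < d] `&`
     [set u | `|(tnth u j).2 - (tnth t j).2| < d])).
  apply: fin_bigcap_measurable => // j _; apply: measurableI; apply: lt_meas.
    exact: measurable_tnth1.
  exact: measurable_tnth2.
by apply/seteqP; split => u /= h j; [move=> _|]; apply: h.
Qed.

(** Such a set is the union of the boxes with rational centre and radius 1 / (k + 1) that it
    contains, and there are countably many of these. *)
Lemma box_open_measurable (O : set (n.-tuple CC)) :
  (forall t, O t -> exists2 d, 0 < d & near_box d t `<=` O) -> measurable O.
Proof.
move=> oO.
pose B (q : n.-tuple (rat * rat) * nat) := near_box q.2.+1%:R^-1 (ratr_tuple q.1).
pose D := [set q | B q `<=` O].
rewrite (_ : O = \bigcup_q (if q \in D then B q else set0)).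
  apply: countable_bigcupT_measurable => [|q]; first exact: countableP.
  by case: ifPn => // _; exact: measurable_near_box.
apply/seteqP; split => [t /= Ot|t [q _]]; last first.
  by case: ifPn => //; rewrite inE => qD; exact: qD.
have [r r0 rO] := oO _ Ot.
(* The radius 1 / (k + 1) is below r / 2, so every point of a rational box containing [t] lies
   within r of [t]. *)
pose k := Num.truncn (2 / r).
have kr : k.+1%:R^-1 < r / 2.
  rewrite -[ltRHS]invrK ltf_pV2 ?posrE ?invr_gt0 ?divr_gt0// invf_div.
  exact: truncnS_gt.
have approx (x : R) : exists q : rat, `|x - ratr q| < k.+1%:R^-1.
  have /rat_in_itvoo[q] : x < x + k.+1%:R^-1 by rewrite ltrDl invr_gt0.
  rewrite in_itv /= => /andP[q1 q2]; exists q.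
  by rewrite distrC ger0_norm ?subr_ge0 ?(ltW q1)// ltrBlDl.
pose qt : n.-tuple (rat * rat) :=
  [tuple (sval (cid (approx (tnth t j).1)), sval (cid (approx (tnth t j).2))) | j < n].
have tq : B (qt, k) t.
  move=> j; rewrite /= !tnth_mktuple /=.
  by split; case: cid.
exists (qt, k) => //; rewrite ifT// inE => u uq /=; apply: rO => j.
have [u1 u2] := uq j; have [t1 t2] := tq j.
have tri (a b c : R) : `|a - c| < k.+1%:R^-1 -> `|b - c| < k.+1%:R^-1 -> `|a - b| < r.
  move=> ac bc; rewrite (le_lt_trans (ler_distD c _ _))//.
  rewrite (splitr r) ltrD// ?(lt_trans ac kr)// distrC; exact: (lt_trans bc kr).
by split; [exact: tri u1 t1|exact: tri u2 t2].
Qed.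

Lemma box_continuous_measurable (F : n.-tuple CC -> R) :
  (forall t e, 0 < e -> exists2 d, 0 < d & forall u, near_box d t u -> `|F t - F u| < e) ->
  measurable_fun setT F.
Proof.
move=> cF; apply: (measurability _ (RGenOInfty.measurableE R)) => //.
move=> _ [_ [a ->] <-]; rewrite setTI; apply: box_open_measurable => t /=.
rewrite in_itv /= andbT => at_.
(* A change of [F] smaller than [F t - a] keeps the value above [a]. *)
have [d d0 dF] := cF t (F t - a) (ltac:(by rewrite subr_gt0)).
exists d => // u /dF; rewrite /= in_itv /= andbT ltr_distlC => /andP[+ _].
by rewrite opprB addrC subrK.
Qed.

End box_continuity.

(** * Measurability of holomorphic functions *)

Lemma differentiable_row_cvg (K : numFieldType) (n : nat) (f : 'rV[K]_n -> K^o) z :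
  differentiable f z -> forall e : K, 0 < e -> exists2 d : K, 0 < d &
    forall w : 'rV[K]_n, (forall j, `|z 0 j - w 0 j| < d) -> `|f z - f w| < e.
Proof.
move=> /differentiable_continuous/cvgr_dist_lt cf e e0.
have /nbhs_ballP[d /= d0 df] := cf _ e0.
exists d => // w zw; apply: df; split=> // i j.
by rewrite (ord1 i); exact: zw.
Qed.

Section holomorphic_measurable.
Context (R : realType) (n : nat).
Local Notation CC := (R * R)%type.
Local Notation normc := (@ComplexField.Normc.normc R).

Lemma gt0_complexP (e : R[i]) : 0 < e -> exists2 r : R, 0 < r & e = (r%:C)%C.
Proof.
case: e => a b; rewrite ltcE /= => /andP[/eqP-> a0]; by exists a.
Qed.

Lemma Re_le_normc (z : R[i]) : `|complex.Re z| <= normc z.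
Proof.
case: z => a b /=; rewrite -sqrtr_sqr ler_wsqrtr// lerDl sqr_ge0//.
Qed.

Lemma Im_le_normc (z : R[i]) : `|complex.Im z| <= normc z.
Proof.
case: z => a b /=; rewrite -sqrtr_sqr ler_wsqrtr// lerDr sqr_ge0//.
Qed.

Lemma normc_le_sum (a b : R) : normc (Complex a b) <= `|a| + `|b|.
Proof.
rewrite /= -[leRHS]ger0_norm ?addr_ge0// -sqrtr_sqr ler_wsqrtr//.
rewrite sqrrD !real_normK ?num_real// -addrA lerD2l addrC lerDl.
by rewrite mulrn_wge0// mulr_ge0.
Qed.

Lemma normc_dist (a b : R[i]) : `|normc a - normc b| <= normc (a - b).
Proof.
rewrite ler_norml lerBlDr lerNl opprB lerBlDr; apply/andP; split.
  rewrite -[normc (a - b)]normcN opprB (le_trans _ (le_normcD _ _))//.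
  by rewrite subrK.
by rewrite (le_trans _ (le_normcD _ _))// subrK.
Qed.

Lemma holomorphic_box (f : 'rV[R[i]]_n -> R[i]) : holomorphic R n f ->
  forall (t : n.-tuple CC) e, 0 < e -> exists2 d, 0 < d & forall u, near_box d t u ->
    normc (f (rowC R n t) - f (rowC R n u)) < e.
Proof.
move=> hf t e e0.
have eC0 : 0 < (e%:C)%C :> R[i] by rewrite ltcR.
have [d /gt0_complexP[r r0 ->] df] := differentiable_row_cvg (hf (rowC R n t)) eC0.
(* The modulus is at most the sum of the real and imaginary displacements, each below r / 2. *)
exists (r / 2); first by rewrite divr_gt0.
move=> u tu; have := df (rowC R n u).
rewrite -ltcR; apply => j; rewrite !mxE ltcR.
have [u1 u2] := tu j; rewrite /toC.
rewrite (le_lt_trans (normc_le_sum _ _))// (splitr r) ltrD// distrC//.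
Qed.

Lemma measurable_holomorphic_Re f : holomorphic R n f ->
  measurable_fun setT (fun t => complex.Re (f (rowC R n t))).
Proof.
move=> hf; apply: box_continuous_measurable => t e e0.
have [d d0 df] := holomorphic_box hf t e0; exists d => // u /df.
apply: le_lt_trans; rewrite -raddfB; exact: Re_le_normc.
Qed.

Lemma measurable_holomorphic_Im f : holomorphic R n f ->
  measurable_fun setT (fun t => complex.Im (f (rowC R n t))).
Proof.
move=> hf; apply: box_continuous_measurable => t e e0.
have [d d0 df] := holomorphic_box hf t e0; exists d => // u /df.
apply: le_lt_trans; rewrite -raddfB; exact: Im_le_normc.
Qed.

Lemma measurable_holomorphic_normc f : holomorphic R n f ->
  measurable_fun setT (fun t => normc (f (rowC R n t))).
Proof.
move=> hf; apply: box_continuous_measurable => t e e0.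
have [d d0 df] := holomorphic_box hf t e0; exists d => // u /df.
exact/le_lt_trans/normc_dist.
Qed.

End holomorphic_measurable.

(** * Elementary bounds for sine, cosine and the real exponential *)

Section trigonometric_bounds.
Context (R : realType).
Implicit Types x : R.

Lemma sin_mvt x : exists2 c, `|c| <= `|x| & sin x = cos c * x.
Proof.
wlog x0 : x / 0 < x.
  move=> H; have [x0|x0|<-] := ltgtP 0 x; first exact: H.
    have [|c cx sx] := H (- x); first by rewrite oppr_gt0.
    exists c; first by rewrite -(normrN x).
    by apply: oppr_inj; rewrite -sinN sx mulrN.
  by exists 0 => //; rewrite sin0 mulr0.
have dsin y : y \in `]0, x[%R -> is_derive y 1 (@sin R) (cos y) by move=> _; exact: is_derive_sin.
have csin : {within `[0, x], continuous (@sin R)}.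
  by apply: continuous_subspaceT => y; exact: continuous_sin.
have [c] := MVT x0 dsin csin.
rewrite in_itv /= sin0 !subr0 => /andP[c0 cx] sx; exists c => //.
by rewrite !gtr0_norm// ltW.
Qed.

Lemma norm_sin_le x : `|sin x| <= `|x|.
Proof.
by have [c _ ->] := sin_mvt x; rewrite normrM ler_piMl// cos_max.
Qed.

Lemma cos_half x : 1 - cos x = 2 * sin (x / 2) ^+ 2.
Proof.
rewrite [in LHS](_ : x = (x / 2) *+ 2); last by rewrite -mulr_natr divfK.
by rewrite cos_mulr2n sin2cos2 -mulr_natl; ring.
Qed.

Lemma cos_ge_sqr x : 0 <= 1 - cos x <= x ^+ 2 / 2.
Proof.
rewrite subr_ge0 cos_le1 cos_half /=.
have := norm_sin_le (x / 2).
rewrite -(ler_pXn2r (isT : (0 < 2)%N)) ?nnegrE// !real_normK ?num_real// => h.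
by have -> : x ^+ 2 / 2 = 2 * (x / 2) ^+ 2; [field|rewrite ler_pM2l].
Qed.

(** Indeed 1 - cos x = 2 sin^2 (x / 2) <= 2 |sin (x / 2)| <= |x| <= exp |x| - 1. The exponential
    form makes the bound of an oscillating factor combine with Gaussian weights. *)
Lemma cos_ge_expR x : 2 - expR `|x| <= cos x.
Proof.
have h1 : 1 - cos x <= `|x|.
  rewrite cos_half.
  have s1 := norm_sin_le (x / 2); have s2 := sin_max (x / 2).
  have -> : sin (x / 2) ^+ 2 = `|sin (x / 2)| ^+ 2 by rewrite real_normK ?num_real.
  have : `|x / 2| = `|x| / 2 by rewrite normrM (@ger0_norm _ 2^-1).
  move: s1 s2 (normr_ge0 (sin (x / 2))).
  set s := `|sin _|; set y := `|_ / _|; nra.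
have := expR_ge1Dx `|x|; lra.
Qed.

Lemma sin_sub_le x : `|x| <= 1 -> `|sin x - x| <= x ^+ 2.
Proof.
move=> x1; have [c cx ->] := sin_mvt x.
have -> : cos c * x - x = - ((1 - cos c) * x) by ring.
have /andP[c0 c1] := cos_ge_sqr c.
rewrite normrN normrM (ger0_norm c0).
have : c ^+ 2 <= x ^+ 2.
  by rewrite -(real_normK (num_real c)) -(real_normK (num_real x)) ler_pXn2r ?nnegrE.
have : x ^+ 2 = `|x| ^+ 2 by rewrite real_normK ?num_real.
move: (normr_ge0 x); set y := `|x| => y0 xy cx2; rewrite xy in cx2 *.
have y2 : 0 <= y ^+ 2 by rewrite exprn_ge0.
have h1 : (1 - cos c) * y <= y ^+ 2 / 2 * y by rewrite ler_wpM2r//; lra.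
have h2 : y ^+ 2 / 2 * y <= y ^+ 2 / 2 by rewrite ler_piMr// divr_ge0.
lra.
Qed.

(** From exp (-x) >= 1 - x follows exp x <= 1 / (1 - x), hence a remainder of at most x^2 / (1 - x),
    where 1 - x >= 1 / 2. *)
Lemma expR_sub_le x : `|x| <= 1 / 2 -> `|expR x - 1 - x| <= 2 * x ^+ 2.
Proof.
rewrite ler_norml => /andP[x1 x2].
have e1 := expR_ge1Dx x; have e2 := expR_ge1Dx (- x).
have e3 : expR x * expR (- x) = 1 by rewrite -expRD subrr expR0.
have e4 := expR_gt0 x.
rewrite ger0_norm; last lra.
have : expR x * (1 - x) <= 1 by rewrite -[leRHS]e3 ler_pM2l.
nra.
Qed.

Lemma expR_sub1_le x : `|x| <= 1 / 2 -> `|expR x - 1| <= 2 * `|x|.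
Proof.
move=> x2; have := expR_sub_le x2; rewrite -(real_normK (num_real x)) => h.
rewrite -[expR x - 1](subrK x) (le_trans (ler_normD _ _))//.
move: (normr_ge0 x) h x2; set y := `|x|; set z := `|_ - _|; nra.
Qed.

End trigonometric_bounds.

(** * The complex exponential and the holomorphic test functions *)

Section complex_exponential.
Context (R : realType).
Local Notation normc := (@ComplexField.Normc.normc R).

Definition cexp (z : R[i]) : R[i] :=
  Complex (expR (complex.Re z) * cos (complex.Im z))
          (expR (complex.Re z) * sin (complex.Im z)).

Lemma cexpD z w : cexp (z + w) = cexp z * cexp w.
Proof.
case: z w => a b [c d]; rewrite /cexp /= expRD cosD sinD; simpc.
by congr Complex; ring.
Qed.

Lemma normc_cexp z : normc (cexp z) = expR (complex.Re z).
Proof.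
by rewrite /= !exprMn -mulrDr cos2Dsin2 mulr1 sqrtr_sqr ger0_norm// expR_ge0.
Qed.

(** Real and imaginary parts split into four terms, each a one-variable remainder or a product of
    two small factors. They contribute 2, 3/4, 2 and 1 times the squared modulus, and 8 is a
    convenient upper bound for the sum. *)
Lemma cexp_taylor h : normc h <= 1 / 2 -> normc (cexp h - 1 - h) <= 8 * normc h ^+ 2.
Proof.
move=> hle; have := Re_le_normc h; have := Im_le_normc h.
case: h hle => a b; set N := normc (Complex a b) => N2 bN aN.
rewrite [complex.Re _]/= in aN; rewrite [complex.Im _]/= in bN.
have a2 : `|a| <= 1 / 2 := le_trans aN N2.
have b2 : `|b| <= 1 / 2 := le_trans bN N2.
have b1 : `|b| <= 1 by lra.
have -> : cexp (Complex a b) - 1 - Complex a b =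
   Complex ((expR a - 1 - a) * cos b - (1 + a) * (1 - cos b))
           ((expR a - 1) * sin b + (sin b - b)).
  by rewrite /cexp /=; simpc; congr Complex; ring.
apply: (le_trans (normc_le_sum _ _)).
have e1 := expR_sub_le a2; have e2 := expR_sub1_le a2.
have s1 := norm_sin_le b; have s2 := sin_sub_le b1.
have /andP[c0 c1] := cos_ge_sqr b.
have a0 := normr_ge0 a; have b0 := normr_ge0 b.
have asq : a ^+ 2 <= N ^+ 2 by rewrite -(real_normK (num_real a)); nra.
have bsq : b ^+ 2 <= N ^+ 2 by rewrite -(real_normK (num_real b)); nra.
have abN : `|a| * `|b| <= N ^+ 2 by nra.
have t1 : `|(expR a - 1 - a) * cos b| <= 2 * N ^+ 2.
  rewrite normrM (le_trans (ler_piMr _ (cos_max b)))//; lra.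
have t2 : `|(1 + a) * (1 - cos b)| <= 3 / 4 * N ^+ 2.
  rewrite normrM (ger0_norm c0).
  have : `|1 + a| <= 3 / 2 by rewrite (le_trans (ler_normD _ _))// normr1; lra.
  have := normr_ge0 (1 + a); nra.
have t3 : `|(expR a - 1) * sin b| <= 2 * N ^+ 2.
  rewrite normrM (le_trans (ler_pM _ _ e2 s1))// -mulrA; lra.
have t4 : `|sin b - b| <= N ^+ 2 by lra.
have t5 := ler_normB ((expR a - 1 - a) * cos b) ((1 + a) * (1 - cos b)).
have t6 := ler_normD ((expR a - 1) * sin b) (sin b - b).
lra.
Qed.

End complex_exponential.

(** After division by h, the quadratic remainder bounds the distance from the difference quotient to
    [l] by C |h|, which tends to 0. *)
Lemma derivable_quadratic_error (K : numFieldType) (f : K^o -> K^o) (z l C e : K) :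
  0 < e -> 0 <= C ->
  (forall h, `|h| <= e -> `|f (h + z) - f z - l * h| <= C * `|h| ^+ 2) ->
  derivable f z 1.
Proof.
move=> e0 C0 H.
suff cv : (fun h : K => h^-1 *: (f (h *: (1 : K^o) + z) - f z)) h @[h --> 0^'] --> (l : K^o).
  exact: (cvgP _ cv).
apply/cvgrPdist_le => /= eps eps0.
(* [C] may vanish, so the radius is obtained by dividing by [C + 1]. *)
have C1 : 0 < C + 1 by rewrite ltr_wpDl.
have d0 : 0 < eps / (C + 1) by rewrite divr_gt0.
near=> h.
have hn0 : h != 0 by near: h; exact: nbhs_dnbhs_neq.
have he : `|h| < e by near: h; exact: dnbhs0_lt.
have hd : `|h| < eps / (C + 1) by near: h; exact: dnbhs0_lt.
have -> : l - h^-1 *: (f (h *: 1 + z) - f z) = - (h^-1 * (f (h + z) - f z - l * h)).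
  have -> : h *: (1 : K^o) = h by exact: mulr1.
  have scE (x : K) : h^-1 *: (x : K^o) = h^-1 * x by [].
  by rewrite scE; field.
rewrite normrN normrM normfV ler_pdivrMl ?normr_gt0// (le_trans (H _ (ltW he)))//.
rewrite expr2 mulrCA ler_pM2l ?normr_gt0//.
rewrite (@le_trans _ _ ((C + 1) * `|h|))//.
  by rewrite ler_wpM2r// lerDl.
by rewrite mulrC -ler_pdivlMr// ltW.
Unshelve. all: by end_near.
Qed.

Section gaussian_functions.
Context (R : realType) (n : nat).
Local Notation normc := (@ComplexField.Normc.normc R).

Lemma derivable_cexp (z : R[i]) : derivable (@cexp R : (R[i])^o -> (R[i])^o) z 1.
Proof.
apply: (@derivable_quadratic_error _ _ _ (cexp z) ((8 * normc (cexp z))%:C)%C ((1 / 2)%:C)%C).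
- by rewrite ltcR.
- by rewrite lecR mulr_ge0// normc_cexp expR_ge0.
move=> h; rewrite lecR => /cexp_taylor hh.
have -> : ((8 * normc (cexp z))%:C)%C * `|h| ^+ 2 = ((8 * normc (cexp z) * normc h ^+ 2)%:C)%C.
  by rewrite [RHS]rmorphM; congr (_ * _); rewrite rmorphXn.
rewrite lecR.
(* The functional equation moves the expansion at [z] to the origin. *)
have -> : cexp (h + z) - cexp z - cexp z * h = cexp z * (cexp h - 1 - h).
  by rewrite cexpD; ring.
rewrite ComplexField.Normc.normcM [8 * _]mulrC -mulrA ler_wpM2l//.
by rewrite normc_cexp expR_ge0.
Qed.

Definition gaussf (s : R) (z : 'rV[R[i]]_n) : R[i] :=
  cexp ((s%:C)%C * \sum_j z 0 j ^+ 2).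

End gaussian_functions.

Lemma differentiable_quadratic_comp (K : numFieldType) (n : nat) (f : K^o -> K^o) (c : K)
    (z : 'rV[K]_n) : (forall w, derivable f w 1) ->
  differentiable ((fun z : 'rV[K]_n => f (c * \sum_j z 0 j ^+ 2)) : 'rV[K]_n -> K^o) z.
Proof.
move=> df.
apply: (@differentiable_comp _ _ K^o K^o (fun z : 'rV[K]_n => c * \sum_j z 0 j ^+ 2 : K^o) f); last first.
  exact/derivable1_diffP.
rewrite (_ : (fun z => _) = c *: (\sum_(j < n) (fun z : 'rV[K]_n => z 0 j : K^o) ^+ 2)).
  apply: differentiableZ; apply: differentiable_sum => j.
  apply: differentiableX; exact: differentiable_coord.
by apply/funext => w; rewrite fctE fct_sumE.
Qed.

Lemma holomorphic_gaussf (R : realType) (n : nat) (s : R) : holomorphic R n (@gaussf R n s).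
Proof.
move=> z; apply: differentiable_quadratic_comp => w; exact: derivable_cexp.
Qed.

(** * The triangle inequality for complex integrals *)

Section complex_integral.
Context (d : measure_display) (T : measurableType d) (R : realType).
Variable mu : {measure set T -> \bar R}.
Local Notation normc := (@ComplexField.Normc.normc R).

Lemma normc_ge0 (z : R[i]) : 0 <= normc z.
Proof. by case: z => a b /=; rewrite sqrtr_ge0. Qed.

Lemma sqr_normc_Complex (a b : R) : normc (Complex a b) ^+ 2 = a ^+ 2 + b ^+ 2.
Proof. by rewrite /= sqr_sqrtr// addr_ge0// sqr_ge0. Qed.

Lemma normc_conjc (z : R[i]) : normc (conjc z) = normc z.
Proof. by case: z => a b /=; rewrite sqrrN. Qed.

Lemma normc_cauchy_schwarz (a b : R) (z : R[i]) :
  a * complex.Re z + b * complex.Im z <= normc (Complex a b) * normc z.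
Proof.
case: z => x y; rewrite [complex.Re _]/= [complex.Im _]/=.
have -> : a * x + b * y = complex.Re (Complex x (- y) * Complex a b) by rewrite /=; ring.
apply: le_trans (ler_norm _) _; apply: le_trans (Re_le_normc _) _.
by rewrite ComplexField.Normc.normcM mulrC /= sqrrN.
Qed.

(** Let a + ib be the integral and N its modulus. Then N^2 = a a + b b is the integral of a Re X + b
    Im X, which by Cauchy-Schwarz is at most N |X| pointwise; divide by N when it is nonzero. *)
Lemma normc_integral_le (X : T -> R[i]) :
  measurable_fun setT (fun t => complex.Re (X t)) ->
  measurable_fun setT (fun t => complex.Im (X t)) ->
  mu.-integrable setT (fun t => (normc (X t))%:E) ->
  normc (Complex (fine (\int[mu]_t (complex.Re (X t))%:E))
                 (fine (\int[mu]_t (complex.Im (X t))%:E)))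
  <= fine (\int[mu]_t (normc (X t))%:E).
Proof.
move=> mR mI iN.
have iR : mu.-integrable setT (fun t => (complex.Re (X t))%:E).
  apply: le_integrable iN => //; first exact/measurable_EFinP.
  by move=> t _; rewrite lee_fin (ger0_norm (normc_ge0 _)) Re_le_normc.
have iI : mu.-integrable setT (fun t => (complex.Im (X t))%:E).
  apply: le_integrable iN => //; first exact/measurable_EFinP.
  by move=> t _; rewrite lee_fin (ger0_norm (normc_ge0 _)) Im_le_normc.
set a := fine _; set b := fine (\int[mu]_t (complex.Im (X t))%:E).
set N := normc _.
have [->|N0] := eqVneq N 0.
  by rewrite fine_ge0// integral_ge0// => t _; rewrite lee_fin normc_ge0.
have Ngt0 : 0 < N by rewrite lt_neqAle eq_sym N0 normc_ge0.
rewrite -(ler_pM2l Ngt0) -expr2 sqr_normc_Complex.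
rewrite !expr2 -[X in _ <= _ * X]/(Rintegral mu setT (fun t => normc (X t))).
rewrite -[X in X * a + _]/a -[X in _ + X * b]/b.
have -> : a * a = Rintegral mu setT (fun t => a * complex.Re (X t)).
  by rewrite RintegralZl.
have -> : b * b = Rintegral mu setT (fun t => b * complex.Im (X t)).
  by rewrite RintegralZl.
have iZ (c : R) (f : T -> R) : mu.-integrable setT (fun t => (f t)%:E) ->
    mu.-integrable setT (EFin \o (fun t => c * f t)).
  by move=> fi; have := integrableZl measurableT c fi.
rewrite -RintegralD//; [|exact: iZ|exact: iZ].
rewrite -RintegralZl//; apply: le_Rintegral => //.
- have := integrableD measurableT (iZ a _ iR) (iZ b _ iI).
  by [].
- exact: iZ.
- by move=> t _; exact: normc_cauchy_schwarz.
Qed.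

End complex_integral.

(** * Hoelder's inequality for Gaussian weights *)

Section gaussian_hoelder.
Context (R : realType) (n : nat) (alpha : R).
Hypothesis alpha0 : 0 < alpha.
Local Notation CC := (R * R)%type.

(** The square root of the unnormalised weight of the pairing, to be attached to each of the two
    factors. *)
Definition half_gauss (t : n.-tuple CC) : R := expR (- (alpha / 2) * sqnorm R n t).

Lemma measurable_half_gauss : measurable_fun setT half_gauss.
Proof.
rewrite /half_gauss; under eq_fun do rewrite gauss_density.
exact: measurable_gauss_Cn.
Qed.

(** The p-th power of [half_gauss] is the weight with exponent alpha p / 2, so the Lebesgue norm is
    the Gaussian one up to normalisation. Finiteness ensures that [fine] keeps the value. *)
Lemma Lnorm_half_gauss (p : R) (F : n.-tuple CC -> R) :
  0 < p -> measurable_fun setT F -> (forall t, 0 <= F t) ->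
  (\int[gaussCn R n (alpha * p / 2)]_t (F t `^ p)%:E < +oo)%E ->
  Lnorm (lebCn R n) p%:E (EFin \o (fun t => F t * half_gauss t)) =
  (((alpha * p / 2 / pi) ^- n) `^ p^-1 *
   fine (\int[gaussCn R n (alpha * p / 2)]_t (F t `^ p)%:E) `^ p^-1)%:E.
Proof.
move=> p0 mF F0 Foo.
have k0 : 0 < (alpha * p / 2 / pi) ^+ n by rewrite exprn_gt0// !divr_gt0 ?mulr_gt0 ?pi_gt0.
have mFp : measurable_fun setT (fun t => F t `^ p).
  exact: (@measurableT_comp _ _ _ _ _ _ (@powR R ^~ p)).
have I0 : (0 <= \int[gaussCn R n (alpha * p / 2)]_t (F t `^ p)%:E)%E.
  have [nu <-] := @gaussCn_ex R n (alpha * p / 2) (ltW (divr_gt0 (mulr_gt0 alpha0 p0) (ltr0Sn _ 1))).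
  by apply: integral_ge0 => t _; rewrite lee_fin powR_ge0.
have IE : (\int[lebCn R n]_t (`|(F t * half_gauss t)%:E| `^ p) =
   ((alpha * p / 2 / pi) ^- n)%:E * \int[gaussCn R n (alpha * p / 2)]_t (F t `^ p)%:E)%E.
  rewrite integral_gaussCn ?divr_ge0 ?mulr_ge0 ?(ltW p0) ?(ltW alpha0)//.
  rewrite -ge0_integralZl//.
  - apply: eq_integral => t _ /=.
    rewrite ger0_norm ?mulr_ge0 ?expR_ge0// -EFinM; congr EFin.
    rewrite powRM ?expR_ge0// -expRM /gaussw.
    rewrite (_ : - (alpha / 2) * sqnorm R n t * p = - (alpha * p / 2) * sqnorm R n t); last by field.
    by rewrite (mulrCA (F t `^ p)) mulKf// gt_eqF.
  - apply/measurable_EFinP; apply: measurable_funM => //; exact: measurable_gaussw.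
  - move=> t _; rewrite lee_fin mulr_ge0 ?powR_ge0 ?gaussw_ge0//.
    by rewrite divr_ge0 ?mulr_ge0 ?(ltW p0) ?(ltW alpha0).
  - by rewrite lee_fin invr_ge0 ltW.
rewrite unlock /= IE.
rewrite -[X in (_ * X)%E]fineK ?ge0_fin_numE// -EFinM poweR_EFin powRM//.
- by rewrite invr_ge0 ltW.
- exact: fine_ge0.
Qed.

Lemma gaussian_hoelder (p p' : R) (F G : n.-tuple CC -> R) :
  0 < p -> 0 < p' -> p^-1 + p'^-1 = 1 ->
  measurable_fun setT F -> (forall t, 0 <= F t) ->
  measurable_fun setT G -> (forall t, 0 <= G t) ->
  (\int[gaussCn R n (alpha * p / 2)]_t (F t `^ p)%:E < +oo)%E ->
  (\int[gaussCn R n (alpha * p' / 2)]_t (G t `^ p')%:E < +oo)%E ->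
  (\int[gaussCn R n alpha]_t (F t * G t)%:E <=
   ((alpha / pi) ^+ n * (((alpha * p / 2 / pi) ^- n) `^ p^-1 *
   fine (\int[gaussCn R n (alpha * p / 2)]_t (F t `^ p)%:E) `^ p^-1 *
   (((alpha * p' / 2 / pi) ^- n) `^ p'^-1 *
   fine (\int[gaussCn R n (alpha * p' / 2)]_t (G t `^ p')%:E) `^ p'^-1)))%:E)%E.
Proof.
move=> p0 p'0 pp' mF F0 mG G0 Foo Goo.
have mh := measurable_half_gauss.
have h0 t : 0 <= half_gauss t by exact: expR_ge0.
have k0 : 0 <= (alpha / pi) ^+ n by rewrite exprn_ge0// divr_ge0 ?pi_ge0 ?(ltW alpha0).
have := hoelder (lebCn R n) (measurable_funM mF mh) (measurable_funM mG mh) p0 p'0 pp'.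
rewrite !Lnorm_half_gauss// -EFinM Lnorm1 => H.
rewrite integral_gaussCn ?(ltW alpha0)//; last exact: measurable_funM.
rewrite (EFinM ((alpha / pi) ^+ n)).
apply: le_trans (lee_wpmul2l _ H); last by rewrite lee_fin.
rewrite -ge0_integralZl//.
- rewrite le_eqVlt; apply/orP; left; apply/eqP; apply: eq_integral => t _ /=.
  rewrite -EFinM ger0_norm ?mulr_ge0//; congr EFin; rewrite /gaussw.
  have -> : expR (- alpha * sqnorm R n t) = half_gauss t * half_gauss t.
    by rewrite /half_gauss -expRD; congr expR; field.
  ring.
- do 2 apply: measurableT_comp => //; exact: measurable_funM (measurable_funM mF mh) (measurable_funM mG mh).
Qed.

(** The powers of alpha / pi cancel because 1/p + 1/p' = 1. For the same reason the powers of 2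
    combine to a single factor 2, leaving the n-th power of [Cp]. *)
Lemma Cp_expn (p p' : R) : 0 < p -> 0 < p' -> p^-1 + p'^-1 = 1 ->
  (alpha / pi) ^+ n * (((alpha * p / 2 / pi) ^- n) `^ p^-1 * ((alpha * p' / 2 / pi) ^- n) `^ p'^-1)
  = Cp R p p' `^ n%:R.
Proof.
move=> p0 p'0 pp'.
have pi0 := pi_gt0 R.
have c0 : 0 < alpha / pi by rewrite divr_gt0.
have E (q : R) : 0 < q -> ((alpha * q / 2 / pi) ^- n) `^ q^-1 =
    ((alpha / pi) `^ (- q^-1) * q `^ (- q^-1) * 2 `^ q^-1) ^+ n.
  move=> q0.
  have sw (z : R) : 0 < z -> alpha * q / 2 / z = alpha / z * q * 2^-1.
    by move=> z0; field; rewrite gt_eqF.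
  rewrite (sw _ pi0); set X := alpha / pi * q * 2^-1.
  have X0 : 0 <= X by apply: mulr_ge0; rewrite ?invr_ge0//; apply: mulr_ge0; exact: ltW.
  rewrite -powR_invn// -powRrM mulNr mulrC -mulNr powRrM powR_mulrn ?powR_ge0//.
  congr (_ ^+ n); have cq0 := mulr_ge0 (ltW c0) (ltW q0).
  rewrite /X (powRM _ cq0) ?invr_ge0// (powRM _ (ltW c0) (ltW q0)).
  by rewrite -[2^-1]powR_inv1// -powRrM mulN1r opprK.
rewrite !E// -!exprMn powR_mulrn; last by rewrite /Cp !mulr_ge0 ?powR_ge0.
congr (_ ^+ n); rewrite /Cp.
have ne0 (x : R) : 0 < x -> x `^ p^-1 * x `^ p'^-1 = x.
  by move=> x0; rewrite -powRD ?pp' ?powRr1 ?(ltW x0)// (gt_eqF x0) implybT.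
rewrite -[X in X * (_ * _)](ne0 _ c0) -[X in _ = X * _ * _](ne0 2)// !powRN.
have c1 := powR_gt0 p^-1 c0; have c2 := powR_gt0 p'^-1 c0.
have q1 := powR_gt0 p^-1 p0; have q2 := powR_gt0 p'^-1 p'0.
by field; rewrite !gt_eqF.
Qed.

End gaussian_hoelder.

(** * The upper bound for the ratio *)

Section upper_bound.
Context (R : realType) (n : nat) (alpha p p' : R).
Hypotheses (alpha0 : 0 < alpha) (p0 : 0 < p) (p'0 : 0 < p') (pp' : p^-1 + p'^-1 = 1).
Local Notation CC := (R * R)%type.
Local Notation normc := (@ComplexField.Normc.normc R).

Lemma normc_inner_le (g h : 'rV[R[i]]_n -> R[i]) :
  Hspace R n p alpha g -> Hspace R n p' alpha h ->
  normc (inner R n alpha g h) <= Cp R p p' `^ n%:R * (pnorm R n p alpha g * pnorm R n p' alpha h).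
Proof.
move=> [hg gp] [hh hp].
have mG := measurable_holomorphic_normc hg.
have mH := measurable_holomorphic_normc hh.
have H := gaussian_hoelder alpha0 p0 p'0 pp' mG (fun t => normc_ge0 _) mH
  (fun t => normc_ge0 _) gp hp.
rewrite (mulrACA (((alpha * p / 2 / pi) ^- n) `^ p^-1)) (mulrA ((alpha / pi) ^+ n)) Cp_expn// in H.
rewrite /pnorm /pint.
have mgR := measurable_holomorphic_Re hg; have mgI := measurable_holomorphic_Im hg.
have mhR := measurable_holomorphic_Re hh; have mhI := measurable_holomorphic_Im hh.
move: H; rewrite /inner; have [nu <-] := @gaussCn_ex R n alpha (ltW alpha0).
move=> H.
have NE t : normc (g (rowC R n t) * conjc (h (rowC R n t))) =
    normc (g (rowC R n t)) * normc (h (rowC R n t)).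
  by rewrite ComplexField.Normc.normcM normc_conjc.
have I0 : (0 <= \int[nu]_t (normc (g (rowC R n t)) * normc (h (rowC R n t)))%:E)%E.
  by apply: integral_ge0 => t _; rewrite lee_fin mulr_ge0 ?normc_ge0.
apply: le_trans (_ : fine (\int[nu]_t (normc (g (rowC R n t) * conjc (h (rowC R n t))))%:E) <= _).
  apply: (normc_integral_le (X := fun t => g (rowC R n t) * conjc (h (rowC R n t)))).
  - rewrite (_ : (fun t => _) = (fun t => complex.Re (g (rowC R n t)) * complex.Re (h (rowC R n t))
      + complex.Im (g (rowC R n t)) * complex.Im (h (rowC R n t)))).
      by apply: measurable_funD; apply: measurable_funM.
    by apply/funext => t; case: (g _) (h _) => a b [c d] /=; ring.
  - rewrite (_ : (fun t => _) = (fun t => complex.Im (g (rowC R n t)) * complex.Re (h (rowC R n t))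
      - complex.Re (g (rowC R n t)) * complex.Im (h (rowC R n t)))).
      by apply: measurable_funB; apply: measurable_funM.
    by apply/funext => t; case: (g _) (h _) => a b [c d] /=; ring.
  - apply/integrableP; split.
      apply/measurable_EFinP; under eq_fun do rewrite NE; exact: measurable_funM.
    under eq_integral do rewrite gee0_abs ?lee_fin ?normc_ge0// NE.
    exact: le_lt_trans H (ltry _).
under eq_integral do rewrite NE.
by rewrite -lee_fin fineK// ge0_fin_numE// (le_lt_trans H (ltry _)).
Qed.

Lemma ratio_le_Cp g h : Hspace R n p alpha g -> Hspace R n p' alpha h ->
  Defs.ratio R n p p' alpha g h <= Cp R p p' `^ n%:R.
Proof.
move=> Hg Hh; have := normc_inner_le Hg Hh; rewrite /Defs.ratio.
set A := pnorm R n p alpha g * _; set C := Cp R p p' `^ n%:R => H.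
have A0 : 0 <= A by rewrite mulr_ge0 ?powR_ge0.
(* If the product of the norms were 0, the quotient would be 0 by the convention on inverses. *)
have [->|An0] := eqVneq A 0; first by rewrite invr0 mulr0 powR_ge0.
by rewrite ler_pdivrMr// lt_neqAle eq_sym An0.
Qed.

End upper_bound.

(** * Norms and pairing of the Gaussian test functions *)

Section lower_bound.
Context (R : realType) (n : nat) (alpha : R).
Hypothesis alpha0 : 0 < alpha.
Local Notation CC := (R * R)%type.
Local Notation normc := (@ComplexField.Normc.normc R).

(** Half the imaginary part of the sum of the z_j^2; it carries the phase of the test functions. *)
Definition xyform (t : n.-tuple CC) : R := \sum_j (tnth t j).1 * (tnth t j).2.

Lemma sum_sqr_rowC (t : n.-tuple CC) :
  \sum_j rowC R n t 0 j ^+ 2 = Complex (qform 1 (-1) t) (2 * xyform t).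
Proof.
rewrite /qform /xyform mulr_sumr.
elim/big_rec3 : _ => // j a b c _ ->.
rewrite mxE /toC expr2; case: (tnth t j) => x y /=; simpc.
by congr Complex; ring.
Qed.

Lemma gaussf_rowC (s : R) t :
  gaussf (alpha * s / 2) (rowC R n t) =
  cexp (Complex (qform (alpha * s / 2) (- (alpha * s / 2)) t) (alpha * s * xyform t)).
Proof.
rewrite /gaussf sum_sqr_rowC; congr cexp; simpc.
rewrite mul_qform mulr1 mulrN1; congr Complex.
by field.
Qed.

Lemma qformD (a b a' b' : R) (t : n.-tuple CC) :
  qform a b t + qform a' b' t = qform (a + a') (b + b') t.
Proof. by rewrite /qform -big_split; apply: eq_bigr => j _ /=; ring. Qed.

Lemma qformN (a b : R) (t : n.-tuple CC) : - qform a b t = qform (- a) (- b) t.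
Proof. by rewrite -mulN1r mul_qform !mulN1r. Qed.

(** With b = alpha p / 2, the weighted p-th power of the modulus is a Gaussian with coefficients b
    (1 - s) and b (1 + s). The normalisation cancels b, so the value depends on neither [p] nor
    [alpha]. *)
Lemma pint_gaussf (p s : R) : 0 < p -> -1 < s < 1 ->
  pint R n p alpha (gaussf (alpha * s / 2)) = (Num.sqrt (1 - s ^+ 2) ^- n)%:E.
Proof.
move=> p0 /andP[s1 s2]; rewrite /pint.
pose b := alpha * p / 2.
have b0 : 0 < b by rewrite divr_gt0 ?mulr_gt0.
have mF : measurable_fun setT (fun t => normc (gaussf (alpha * s / 2) (rowC R n t)) `^ p).
  apply: (@measurableT_comp _ _ _ _ _ _ (@powR R ^~ p)) => //.
  exact: measurable_holomorphic_normc (@holomorphic_gaussf R n _).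
rewrite integral_gaussCn ?(ltW b0)//.
have pi0 := pi_gt0 R.
have c1 : 0 < b * (1 - s) by rewrite mulr_gt0// subr_gt0.
have c2 : 0 < b * (1 + s) by rewrite mulr_gt0//; lra.
under eq_integral => t _.
  rewrite gaussf_rowC normc_cexp [complex.Re _]/= -expRM /gaussw gauss_density mulrCA -expRD.
  rewrite (_ : _ + _ = - qform (b * (1 - s)) (b * (1 + s)) t); last first.
    rewrite mulrC mul_qform qformN qformD qformN /b.
    by congr qform; field.
  rewrite EFinM; over.
rewrite /= ge0_integralZl//; last 2 first.
- by apply/measurable_EFinP; exact: measurable_gauss_Cn.
- by rewrite lee_fin exprn_ge0// divr_ge0// ?ltW.
rewrite gauss_integral_Cn// -EFinM -exprMn -exprVn; congr (_ ^+ n)%:E.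
have -> : b * (1 - s) * (b * (1 + s)) = b ^+ 2 * (1 - s ^+ 2) by ring.
rewrite sqrtrM ?sqr_ge0// sqrtr_sqr gtr0_norm// -/b.
have S0 : 0 < Num.sqrt (1 - s ^+ 2) by rewrite sqrtr_gt0; nra.
by move: (pi : R) pi0 (Num.sqrt _) S0 => x x0 S S0; field; rewrite !gt_eqF.
Qed.

Lemma gaussf_Hspace (p s : R) : 0 < p -> -1 < s < 1 ->
  Hspace R n p alpha (gaussf (alpha * s / 2)).
Proof.
move=> p0 s1; split; first exact: holomorphic_gaussf.
by rewrite pint_gaussf// ltry.
Qed.

Lemma gaussf_neq0 (s : R) : @gaussf R n s <> (fun=> 0).
Proof.
move=> /(congr1 (fun f => f 0)); rewrite /gaussf => /(congr1 (@complex.Re R)).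
rewrite big1 => [|j _]; last by rewrite mxE expr0n.
by rewrite mulr0 /= expR0 cos0 mulr1 => /eqP; rewrite oner_eq0.
Qed.

Lemma Re_gaussf_conj (s t : R) u :
  complex.Re (gaussf (alpha * s / 2) (rowC R n u) * conjc (gaussf (alpha * t / 2) (rowC R n u))) =
  expR (qform (alpha * (s + t) / 2) (- (alpha * (s + t) / 2)) u) *
  cos (alpha * (s - t) * xyform u).
Proof.
rewrite !gaussf_rowC /cexp /=.
rewrite (_ : alpha * (s - t) * xyform u = alpha * s * xyform u - alpha * t * xyform u); last by ring.
rewrite cosB.
rewrite (_ : qform (alpha * (s + t) / 2) _ u = qform (alpha * s / 2) (- (alpha * s / 2)) u +
  qform (alpha * t / 2) (- (alpha * t / 2)) u); last by rewrite qformD; congr qform; field.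
by rewrite expRD; ring.
Qed.

(** This is 2 d |x| |y| <= d^2 x^2 + y^2 up to a factor. The uneven weights match the pairing, whose
    decay is only of order d^2 in x but of order 1 in y: each error term is smaller by a factor of
    order d. *)
Lemma norm_xyform_le (k d : R) u : 0 < d -> `|k| <= d ^+ 2 ->
  `|alpha * k * xyform u| <= qform (alpha * d ^+ 3 / 2) (alpha * d / 2) u.
Proof.
move=> d0 kd; rewrite /xyform mulr_sumr (le_trans (ler_norm_sum _ _ _))//.
apply: ler_sum => j _; rewrite !normrM gtr0_norm//.
set x := (tnth u j).1; set y := (tnth u j).2.
rewrite -(real_normK (num_real x)) -(real_normK (num_real y)).
move: (normr_ge0 x) (normr_ge0 y) => x0 y0.
apply: (@le_trans _ _ (alpha * (d ^+ 2 * (`|x| * `|y|)))).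
  by rewrite -mulrA ler_pM2l// ler_wpM2r// mulr_ge0.
rewrite -subr_ge0.
rewrite (_ : _ - _ = alpha * d / 2 * (d * `|x| - `|y|) ^+ 2); last by field.
by rewrite mulr_ge0 ?sqr_ge0// divr_ge0// mulr_ge0 ?ltW.
Qed.

Lemma integrable_gauss_Cn (a c : R) : 0 < a -> 0 < c ->
  (lebCn R n).-integrable setT (EFin \o (fun t => expR (- qform a c t))).
Proof.
move=> a0 c0; apply/integrableP; split.
  by apply/measurable_EFinP; exact: measurable_gauss_Cn.
under eq_integral do rewrite /= ger0_norm ?expR_ge0//.
by rewrite gauss_integral_Cn// ltry.
Qed.

(** The modulus is bounded below by the real part, whose integrand dominates the difference [L] of
    two Gaussians. The first term of the bound comes from the unperturbed Gaussian, the second from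
    the one widened by the phase estimate. *)
Lemma inner_gaussf_ge (s t d : R) : 0 < d < 1 -> s + t = 2 - d ^+ 2 -> `|s - t| <= d ^+ 2 ->
  2 * d ^- n - (d * (1 - d)) ^- n <=
  normc (inner R n alpha (gaussf (alpha * s / 2)) (gaussf (alpha * t / 2))).
Proof.
move=> /andP[d0 d1] st sd.
apply: le_trans (Re_le_normc _); apply: le_trans (ler_norm _).
rewrite [complex.Re _]/=.
have pi0 := pi_gt0 R.
set U := fun u => expR (qform (alpha * (s + t) / 2) (- (alpha * (s + t) / 2)) u) *
  cos (alpha * (s - t) * xyform u).
have -> : (fun u => (complex.Re (gaussf (alpha * s / 2) (rowC R n u) *
    conjc (gaussf (alpha * t / 2) (rowC R n u))))%:E) = (EFin \o U).
  by apply/funext => u; rewrite Re_gaussf_conj.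
have mU : measurable_fun setT U.
  apply: measurable_funM.
    by apply: measurableT_comp => //; exact: measurable_qform.
  apply: measurableT_comp => //; first exact: continuous_measurable_fun (@continuous_cos R).
  apply: measurable_funM => //; apply: measurable_sum => j; apply: measurable_funM.
    exact: measurable_tnth1.
  exact: measurable_tnth2.
rewrite integral_gaussCn ?(ltW alpha0)//.
(* [a] and [c] are the coefficients of the integrand of the pairing; [a'] and [c'] are what remains
   after subtracting the phase bound of [norm_xyform_le]. *)
pose a := alpha * d ^+ 2 / 2; pose c := alpha * (2 - d ^+ 2 / 2).
pose a' := alpha * d ^+ 2 * (1 - d) / 2; pose c' := alpha * (2 - d ^+ 2 / 2 - d / 2).
have a0 : 0 < a by rewrite divr_gt0// mulr_gt0// exprn_gt0.
have c0 : 0 < c by rewrite mulr_gt0//; nra.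
have a'0 : 0 < a' by rewrite divr_gt0// !mulr_gt0 ?exprn_gt0// subr_gt0.
have c'0 : 0 < c' by rewrite mulr_gt0//; nra.
pose k := (alpha / pi) ^+ n.
have k0 : 0 < k by rewrite exprn_gt0// divr_gt0.
have UE u : U u * gaussw alpha u = k * (expR (- qform a c u) * cos (alpha * (s - t) * xyform u)).
  rewrite /U /gaussw -/k gauss_density mulrCA; congr (_ * _); rewrite mulrAC -expRD.
  by congr (expR _ * _); rewrite qformN qformD qformN st /a /c; congr qform; field.
under eq_integral do rewrite UE.
pose L (u : n.-tuple CC) := k * (2 * expR (- qform a c u) - expR (- qform a' c' u)).
have iG := integrable_gauss_Cn a0 c0; have iG' := integrable_gauss_Cn a'0 c'0.
have LU u : L u <= k * (expR (- qform a c u) * cos (alpha * (s - t) * xyform u)).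
  rewrite ler_pM2l//.
  have h1 := cos_ge_expR (alpha * (s - t) * xyform u).
  have h2 := norm_xyform_le u d0 sd.
  apply: (@le_trans _ _ (expR (- qform a c u) * (2 - expR `|alpha * (s - t) * xyform u|))); last first.
    by rewrite ler_pM2l ?expR_gt0.
  rewrite mulrBr mulrC lerD2l lerN2 -expRD ler_expR.
  have -> : - qform a' c' u = - qform a c u + qform (alpha * d ^+ 3 / 2) (alpha * d / 2) u.
    by rewrite !qformN qformD /a /a' /c /c'; congr qform; field.
  by rewrite lerD2l.
have iZ (x : R) (f : n.-tuple CC -> R) : (lebCn R n).-integrable setT (EFin \o f) ->
    (lebCn R n).-integrable setT (EFin \o (fun t => x * f t)).
  by move=> fi; exact: (integrableZl measurableT x fi).
have iL0 : (lebCn R n).-integrable setT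
    (EFin \o (fun u => 2 * expR (- qform a c u) - expR (- qform a' c' u))).
  exact: (integrableB measurableT (iZ 2 _ iG) iG').
have mUw : measurable_fun setT (fun u => k * (expR (- qform a c u) * cos (alpha * (s - t) * xyform u))).
  rewrite (_ : (fun u => _) = (fun u => U u * gaussw alpha u)); last exact/funext.
  by apply: measurable_funM => //; exact: measurable_gaussw.
have iU : (lebCn R n).-integrable setT
    (EFin \o (fun u => k * (expR (- qform a c u) * cos (alpha * (s - t) * xyform u)))).
  apply: le_integrable (iZ k _ iG) => //; first exact/measurable_EFinP.
  move=> u _ /=; rewrite lee_fin !normrM !(ger0_norm (expR_ge0 _)).
  by rewrite ler_wpM2l// ler_piMr ?expR_ge0// cos_max.
apply: le_trans (le_Rintegral measurableT (iZ k _ iL0) iU (fun u _ => LU u)).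
rewrite RintegralZl// RintegralB//; last exact: (iZ 2 _ iG).
rewrite RintegralZl// /Rintegral !gauss_integral_Cn//=.
rewrite (mulrBr k) (mulrCA k) /k -!exprMn.
(* This amounts to a c <= (alpha d)^2. *)
have e1 : d^-1 <= alpha / pi * (pi / Num.sqrt (a * c)).
  rewrite mulrA divfK ?gt_eqF// -[leLHS]mul1r -(mulfV (lt0r_neq0 alpha0)) -(mulrA alpha alpha^-1) -invfM ler_pM2l//.
  rewrite lef_pV2 ?posrE ?sqrtr_gt0 ?(mulr_gt0 a0 c0) ?(mulr_gt0 alpha0 d0)//.
  rewrite -[leRHS]gtr0_norm ?(mulr_gt0 alpha0 d0)// -sqrtr_sqr ler_wsqrtr// /a /c.
  rewrite -subr_ge0 (_ : _ - _ = (alpha * d ^+ 2) ^+ 2 / 4); last by field.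
  by rewrite divr_ge0 ?sqr_ge0.
(* This amounts to a' c' >= (alpha d (1 - d))^2. *)
have e2 : alpha / pi * (pi / Num.sqrt (a' * c')) <= (d * (1 - d))^-1.
  have dd : 0 < 1 - d by rewrite subr_gt0.
  set D := d * (1 - d); have D0 : 0 < D by rewrite mulr_gt0.
  rewrite mulrA divfK ?gt_eqF// -[leRHS]mul1r -(mulfV (lt0r_neq0 alpha0)) -(mulrA alpha alpha^-1) -invfM ler_pM2l//.
  rewrite lef_pV2 ?posrE ?sqrtr_gt0 ?(mulr_gt0 a'0 c'0) ?(mulr_gt0 alpha0 D0)//.
  rewrite -[leLHS]gtr0_norm ?(mulr_gt0 alpha0 D0)// -sqrtr_sqr ler_wsqrtr// /a' /c' /D.
  rewrite -subr_ge0 (_ : _ - _ = (alpha * d) ^+ 2 * (1 - d) * d * (3 - d) / 4); last by field.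
  apply: divr_ge0 => //; apply: mulr_ge0; last by lra.
  apply: mulr_ge0; last exact: ltW.
  by apply: mulr_ge0; [exact: sqr_ge0|exact: ltW].
rewrite -!exprVn lerB//.
  by rewrite ler_pM2l// lerXn2r ?nnegrE ?invr_ge0 ?(ltW d0)// (le_trans _ e1)// invr_ge0 ltW.
rewrite lerXn2r ?nnegrE ?(le_trans _ e2)// mulr_ge0// divr_ge0// ?ltW//.
Qed.

End lower_bound.

(** * Test functions whose ratio approaches the lower constant *)

Section near_optimal_ratio.
Context (R : realType) (n : nat) (alpha p p' : R).
Hypotheses (alpha0 : 0 < alpha) (p1 : 1 < p) (p'1 : 1 < p') (pp' : p^-1 + p'^-1 = 1).

(** With e = d^2 / q the radicand is e (2 - e), so the root behaves like d sqrt (2 / q) for small d.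
    The factor 1 - d turns this into a lower bound, since 2 (1 - d)^2 <= 2 - e. *)
Lemma one_sub_sqr_bounds (q d : R) : 1 < q -> 0 < d < 1 ->
  (-1 < 1 - d ^+ 2 / q < 1) /\
  d * (1 - d) * Num.sqrt (2 / q) <= Num.sqrt (1 - (1 - d ^+ 2 / q) ^+ 2).
Proof.
move=> q1 /andP[d0 d1].
have q0 : 0 < q by apply: lt_trans q1.
have d2 : 0 < d ^+ 2 by rewrite exprn_gt0.
have d21 : d ^+ 2 < 1 by rewrite expr_lt1// ltW.
have e0 : 0 < d ^+ 2 / q by rewrite divr_gt0.
have e1 : d ^+ 2 / q < d ^+ 2 by rewrite ltr_pdivrMr// ltr_pMr.
split; first by lra.
have D0 : 0 <= d * (1 - d) by rewrite mulr_ge0 ?subr_ge0 ?ltW.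
rewrite -[X in X * _](ger0_norm D0) -sqrtr_sqr -sqrtrM ?sqr_ge0// ler_wsqrtr//.
have -> : 1 - (1 - d ^+ 2 / q) ^+ 2 = d ^+ 2 / q * (2 - d ^+ 2 / q) by ring.
have -> : (d * (1 - d)) ^+ 2 * (2 / q) = d ^+ 2 / q * (2 * (1 - d) ^+ 2).
  by field; rewrite gt_eqF.
rewrite ler_pM2l//; nra.
Qed.

(** The bound separates a factor in d, which cancels against the pairing once q = p and q = p' are
    multiplied, from a factor in q, which produces [Cp]. Positivity of the norm permits division by
    it. *)
Lemma pnorm_gaussf_le (q d : R) : 1 < q -> 0 < d < 1 ->
  0 < pnorm R n q alpha (gaussf (alpha * (1 - d ^+ 2 / q) / 2)) <=
  ((d * (1 - d)) ^- n) `^ q^-1 * (Num.sqrt (2 / q) ^- n) `^ q^-1.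
Proof.
move=> q1 d01; have [s1 Sle] := one_sub_sqr_bounds q1 d01; case/andP: d01 => d0 d1.
have q0 : 0 < q by apply: lt_trans q1.
have D0 : 0 < d * (1 - d) by rewrite mulr_gt0 ?subr_gt0.
have Q0 : 0 < Num.sqrt (2 / q) by rewrite sqrtr_gt0 divr_gt0.
have S0 := lt_le_trans (mulr_gt0 D0 Q0) Sle.
rewrite /pnorm pint_gaussf//= powR_gt0 ?invr_gt0 ?exprn_gt0//=.
have Di0 : 0 <= (d * (1 - d)) ^- n by rewrite invr_ge0 exprn_ge0 ?ltW.
have Qi0 : 0 <= Num.sqrt (2 / q) ^- n by rewrite invr_ge0 exprn_ge0 ?ltW.
have Si0 : 0 <= Num.sqrt (1 - (1 - d ^+ 2 / q) ^+ 2) ^- n by rewrite invr_ge0 exprn_ge0 ?ltW.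
rewrite -powRM//; apply: (ge0_ler_powR (r := q^-1)) => //.
- by rewrite invr_ge0 ltW.
- by rewrite nnegrE mulr_ge0.
rewrite -invfM -exprMn lef_pV2 ?posrE ?exprn_gt0 ?(mulr_gt0 D0 Q0)//.
by rewrite lerXn2r ?nnegrE ?(ltW S0) ?(ltW (mulr_gt0 D0 Q0)).
Qed.

Lemma Cp_half_powR :
  (Num.sqrt (2 / p) ^- n) `^ p^-1 * (Num.sqrt (2 / p') ^- n) `^ p'^-1 =
  (Cp R p p' `^ (n%:R / 2))^-1.
Proof.
(* Both sides are written as exponentials, so that the identity becomes linear in the logarithms of
   2, p and p'. *)
have p0 : 0 < p by apply: lt_trans p1.
have p'0 : 0 < p' by apply: lt_trans p'1.
have powRE (x r : R) : 0 < x -> x `^ r = expR (r * ln x).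
  by move=> x0; rewrite /powR gt_eqF.
have E (q : R) : 0 < q -> (Num.sqrt (2 / q) ^- n) `^ q^-1 =
    expR (- (n%:R / 2) * (q^-1 * ln 2 - q^-1 * ln q)).
  move=> q0; have Q0 : 0 < 2 / q by rewrite divr_gt0.
  rewrite -powR_invn ?sqrtr_ge0// -powR12_sqrt ?(ltW Q0)// -!powRrM powRE//.
  by congr expR; rewrite ln_div ?posrE//; field; rewrite gt_eqF.
have C0 : 0 < Cp R p p' by rewrite /Cp !mulr_gt0 ?powR_gt0.
rewrite !E// -expRD -powRN powRE// /Cp.
rewrite !lnM ?posrE ?mulr_gt0 ?powR_gt0// !ln_powR; congr expR.
have -> : p^-1 = 1 - p'^-1 by rewrite -pp' addrK.
by field; rewrite gt_eqF.
Qed.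

Lemma near_optimal_ratio (d : R) : 0 < d < 1 -> 0 <= 2 * (1 - d) ^+ n - 1 ->
  (2 * (1 - d) ^+ n - 1) * Cp R p p' `^ (n%:R / 2) <=
  Defs.ratio R n p p' alpha (gaussf (alpha * (1 - d ^+ 2 / p) / 2))
                       (gaussf (alpha * (1 - d ^+ 2 / p') / 2)).
Proof.
move=> d01 B0; have /andP[d0 d1] := d01.
have d2 : 0 < d ^+ 2 by rewrite exprn_gt0.
have D0 : 0 < d * (1 - d) by rewrite mulr_gt0 ?subr_gt0.
have p0 : 0 < p^-1 by rewrite invr_gt0 (lt_trans _ p1).
have p'0 : 0 < p'^-1 by rewrite invr_gt0 (lt_trans _ p'1).
have st : (1 - d ^+ 2 / p) + (1 - d ^+ 2 / p') = 2 - d ^+ 2.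
  transitivity (2 - d ^+ 2 * (p^-1 + p'^-1)); first by ring.
  by rewrite pp' mulr1.
have inv_dist : `|p'^-1 - p^-1| <= 1.
  move: p0 p'0 pp'; move: (p^-1) (p'^-1) => a b a0 b0 ab.
  by rewrite ler_norml; apply/andP; split; lra.
have sd : `|(1 - d ^+ 2 / p) - (1 - d ^+ 2 / p')| <= d ^+ 2.
  rewrite (_ : _ - _ = d ^+ 2 * (p'^-1 - p^-1)); last by ring.
  by rewrite normrM gtr0_norm// ler_piMr ?(ltW d2).
(* The exponents 1/p and 1/p' add up to 1, so the singular factors of the two norms recombine into
   one. *)
have D1 : ((d * (1 - d)) ^- n) `^ p^-1 * ((d * (1 - d)) ^- n) `^ p'^-1 = (d * (1 - d)) ^- n.
  have Dn : 0 < (d * (1 - d)) ^- n by rewrite invr_gt0 exprn_gt0.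
  by rewrite -powRD ?pp' ?powRr1 ?(ltW Dn)// (gt_eqF Dn) implybT.
have C0 : 0 < Cp R p p' `^ (n%:R / 2).
  by rewrite powR_gt0// /Cp !mulr_gt0 ?powR_gt0// -invr_gt0.
have /andP[P0 Ple] := pnorm_gaussf_le p1 d01.
have /andP[P'0 P'le] := pnorm_gaussf_le p'1 d01.
have PP0 := mulr_gt0 P0 P'0.
rewrite /Defs.ratio (ler_pdivlMr _ _ PP0).
apply: le_trans (inner_gaussf_ge n alpha0 d01 st sd).
have PP := ler_pM (ltW P0) (ltW P'0) Ple P'le.
rewrite mulrACA D1 Cp_half_powR in PP.
apply: (@le_trans _ _ ((2 * (1 - d) ^+ n - 1) * (d * (1 - d)) ^- n)).
  apply: le_trans (ler_wpM2l (mulr_ge0 B0 (ltW C0)) PP) _.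
  by rewrite -(mulrA (_ - 1)) (mulrCA (Cp R p p' `^ _)) mulfV ?gt_eqF// mulr1.
(* What remains is (1 - d)^n (d (1 - d))^-n = d^-n, with a factor 2 on both sides. *)
rewrite mulrBl mul1r lerD2r.
have d1' : 0 < 1 - d by rewrite subr_gt0.
rewrite exprMn invfM -mulrA ler_pM2l// mulrCA mulfV ?mulr1// gt_eqF// exprn_gt0//.
Qed.

End near_optimal_ratio.

(** * Bernoulli's inequality and the bounds for the supremum *)

Lemma expr_ge_linear (R : realType) (n : nat) (d : R) : 0 <= d <= 1 -> 1 - n%:R * d <= (1 - d) ^+ n.
Proof.
move=> /andP[d0 d1]; elim: n => [|n IH]; first by rewrite mul0r subr0.
rewrite exprS -natr1.
have n0 : 0 <= n%:R :> R by [].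
have : (1 - d) * (1 - n%:R * d) <= (1 - d) * (1 - d) ^+ n by rewrite ler_wpM2l// subr_ge0.
apply: le_trans; rewrite -subr_ge0.
rewrite (_ : _ - _ = n%:R * d ^+ 2); last by ring.
by rewrite mulr_ge0// sqr_ge0.
Qed.

Unset Implicit Arguments.

Theorem theorem1p5 (R : realType) (n : nat) (alpha p p' : R) :
  (0 < n)%N -> 0 < alpha -> 1 < p -> p^-1 + p'^-1 = 1 ->
  ((Cp R p p' `^ (n%:R / 2))%:E <= ereal_sup (EFin @` ratios R n p p' alpha))%E /\
  (ereal_sup (EFin @` ratios R n p p' alpha) <= (Cp R p p' `^ n%:R)%:E)%E.
Proof.
move=> n0 alpha0 p1 pp'.
have p0 : 0 < p by apply: lt_trans p1.
have pi1 : 0 < p^-1 < 1 by rewrite invr_gt0 p0 invf_lt1.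
have p'i : 0 < p'^-1 by lra.
have p'0 : 0 < p' by rewrite -invr_gt0.
have p'1 : 1 < p' by rewrite -invf_lt1//; lra.
split; last first.
  apply: ge_ereal_sup => _ [_ [g [h [Hg _ Hh _ ->]]] <-]; rewrite lee_fin.
  by apply: ratio_le_Cp => //; rewrite -inE.
(* It suffices to reach every fraction r < 1 of the lower constant, so no limit d -> 0 has to be
   taken. *)
apply/lee_mul01Pr => [|r /andP[r0 r1]]; first by rewrite lee_fin powR_ge0.
(* With n d = (1 - r) / 2, Bernoulli's inequality gives 2 (1 - d)^n - 1 >= r. *)
pose d := (1 - r) / (2 * n%:R).
have nR : 1 <= n%:R :> R by rewrite ler1n.
have d0 : 0 < d by rewrite divr_gt0 ?subr_gt0// mulr_gt0// ltr0n.
have nd : n%:R * d = (1 - r) / 2.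
  by rewrite /d; field; rewrite pnatr_eq0 -lt0n.
have d1 : d < 1.
  have : d <= n%:R * d by rewrite ler_peMl// ltW.
  lra.
have dd : 0 <= d <= 1 by rewrite !ltW.
have B := expr_ge_linear n dd; rewrite nd in B.
apply: (@le_trans _ _ ((2 * (1 - d) ^+ n - 1) * Cp R p p' `^ (n%:R / 2))%:E).
  by rewrite -EFinM lee_fin ler_wpM2r ?powR_ge0//; lra.
have d01 : 0 < d < 1 by rewrite d0 d1.
apply: (@le_trans _ _ (Defs.ratio R n p p' alpha (gaussf (alpha * (1 - d ^+ 2 / p) / 2))
                       (gaussf (alpha * (1 - d ^+ 2 / p') / 2)))%:E).
  by rewrite lee_fin; apply: near_optimal_ratio => //; lra.
apply: ereal_sup_ubound; eexists; last reflexivity.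
exists (gaussf (alpha * (1 - d ^+ 2 / p) / 2)), (gaussf (alpha * (1 - d ^+ 2 / p') / 2)).
split=> //; try exact: gaussf_neq0.
- by rewrite inE; apply: gaussf_Hspace => //; have [] := one_sub_sqr_bounds p1 d01.
- by rewrite inE; apply: gaussf_Hspace => //; have [] := one_sub_sqr_bounds p'1 d01.
Qed.
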